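(* Let $A=(A_t)_{t\ge 0}$ be an increasing process and let $f:\mathbb{R}_+\to\mathbb{R}_+$ be a right-continuous non-decreasing function with associated Stieltjes measure $\mathrm{d}f$. Let $\mathbb{L}(A)$ be the set of $x>0$ which are left-accessible for $A$ with positive probability, and write $f(\mathbb{L}(A))$ for the mass that $\mathrm{d}f$ assigns to $\mathbb{L}(A)$. (i) If $f(\mathbb{L}(A))=0$, then almost surely, for all $t\ge 0$, $$f(A_t)-f(0)=\sum_{0<s\le t}\bigl(f(A_s)-f(A_{s-})\bigr).$$ (ii) If $f(\mathbb{L}(A))>0$, then for all sufficiently large $t>0$ the strict inequality $$f(A_t)-f(0)>\sum_{0<s\le t}\bigl(f(A_s)-f(A_{s-})\bigr)$$ holds with positive probability.
   Context: $\mathbb{R}_+=[0,\infty)$. An increasing process $A=(A_t)_{t\ge 0}$ is a random process with values in $\mathbb{R}_+$, defined on a probability space with probability $\mathbb{P}$, such that with probability one $A_0=0$ and the sample path $t\mapsto A_t$ is right-continuous and non-decreasing. $A_{s-}$ denotes the left limit of the path at $s>0$, and $f(A_{s-})$ denotes the value of $f$ at the point $A_{s-}$. For $x>0$ let $L(x)=\sup\{t\ge 0: A_t<x\}$. A point $x>0$ is left-accessible for the sample path $A(\omega)$ if $L(x)<\infty$ and $A_{L(x)-}(\omega)=x$. Let $\mathcal{L}(A)$ be the random set of left-accessible points of $A$, and let $\mathbb{L}(A)=\{x>0:\mathbb{P}(x\in\mathcal{L}(A))>0\}$ (a deterministic set). For a Borel set $B\subseteq\mathbb{R}_+$, $f(B)$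 denotes the mass assigned to $B$ by the Stieltjes measure $\mathrm{d}f$, so that $f((x,y])=f(y)-f(x)$ for $0\le x\le y$. The sums over $0<s\le t$ are sums of non-negative terms, in which only the at most countably many jump times of $A$ can contribute. *)

(* Defs.v *)
From HB Require Import structures.
From mathcomp Require Import all_boot all_order all_algebra.
From mathcomp Require Import all_classical all_reals all_analysis.

Set Implicit Arguments.
Unset Strict Implicit.
Unset Printing Implicit Defensive.
Import Order.TTheory GRing.Theory Num.Theory.
Import numFieldNormedType.Exports.
Local Open Scope classical_set_scope.
Local Open Scope ring_scope.

(* [0, +oo) is handled by relativization: functions on it and processes indexed
   by it are functions on R whose values at negative arguments are irrelevant. *)

Definition right_continuous_ge0 (R : realType) (g : R -> R) :=
  forall x, 0 <= x -> g u @[u --> x^'+] --> g x.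

Definition nondecreasing_ge0 (R : realType) (g : R -> R) :=
  forall x y, 0 <= x -> x <= y -> g x <= g y.

(* Right-continuous non-decreasing functions from [0, +oo) to [0, +oo). *)
Record stieltjes_fun (R : realType) := StieltjesFun {
  stieltjes_fun_val :> R -> R ;
  stieltjes_fun_ge0 : forall x, 0 <= x -> 0 <= stieltjes_fun_val x ;
  stieltjes_fun_nd : nondecreasing_ge0 stieltjes_fun_val ;
  stieltjes_fun_rc : right_continuous_ge0 stieltjes_fun_val }.

(* The library's Stieltjes measures live on R, so f is first extended by the
   constant f 0 to the negative half-line; `]-oo, 0] gets mass 0. *)
Definition extend_left (R : realType) (f : stieltjes_fun R) (x : R) : R :=
  f (Num.max 0 x).

Section extend_left_cumulative.
Variables (R : realType) (f : stieltjes_fun R).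

Let extend_left_nd : {homo extend_left f : x y / x <= y}.
Proof.
move=> x y xy; apply: stieltjes_fun_nd; first by rewrite le_max lexx.
by rewrite ge_max !le_max lexx xy orbT.
Qed.

Let extend_left_rc : right_continuous (extend_left f).
Proof.
move=> x; have [x0|x0] := leP 0 x.
  have -> : extend_left f x = f x by rewrite /extend_left max_r.
  apply: cvg_trans (stieltjes_fun_rc x0); apply: near_eq_cvg.
  near=> u; rewrite /extend_left max_r//.
  by apply: le_trans x0 _; near: u; exact: nbhs_right_ge.
have -> : extend_left f x = f 0 by rewrite /extend_left max_l// ltW.
apply: cvg_near_cst; near=> u; rewrite /extend_left max_l//.
by near: u; exact: nbhs_right_le.
Unshelve. all: by end_near. Qed.

HB.instance Definition _ :=
  isCumulative.Build R _ R (extend_left f) extend_left_nd extend_left_rc.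
End extend_left_cumulative.

Definition stieltjes_measure (R : realType) (f : stieltjes_fun R) :=
  lebesgue_stieltjes_measure (extend_left f).

Lemma stieltjes_measure_itv (R : realType) (f : stieltjes_fun R) (x y : R) :
  0 <= x -> x <= y -> stieltjes_measure f `]x, y] = (f y - f x)%:E.
Proof.
move=> x0 xy; rewrite /stieltjes_measure /lebesgue_stieltjes_measure.
rewrite /measure_extension measurable_mu_extE/=; last exact: is_ocitv.
rewrite wlength_itv_bnd// /extend_left !max_r//.
exact: le_trans x0 xy.
Qed.

Section paths.
Variable R : realType.
Implicit Types (a : R -> R) (t s x : R).

Definition increasing_path a :=
  [/\ a 0 = 0, right_continuous_ge0 a & nondecreasing_ge0 a].

Definition left_lim a s : R := lim (a u @[u --> s^'-]).

Definition last_time_below a x : \bar R :=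
  ereal_sup [set t%:E | t in [set t | 0 <= t /\ a t < x]].

Definition left_accessible a x :=
  [/\ 0 < x, (last_time_below a x < +oo)%E &
      left_lim a (fine (last_time_below a x)) = x].

Definition jump_sum (f : R -> R) a t : \bar R :=
  \esum_(s in [set s | 0 < s <= t]) (f (a s) - f (left_lim a s))%:E.

End paths.

Section processes.
Context d (T : measurableType d) (R : realType) (P : probability T R).

Definition increasing_process (A : R -> T -> R) :=
  [/\ forall t, 0 <= t -> measurable_fun setT (A t),
      forall t omega, 0 <= t -> 0 <= A t omega &
      {ae P, forall omega, increasing_path (A ^~ omega)}].

(* Paths are regular only almost surely, so path events are measurable only up
   to a null set, and P itself is meaningless off its sigma-algebra; hence the
   completion of P (as a total function, the outer measure induced by P). *)
Definition completed_prob (E : set T) : \bar R :=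
  @completed_measure_extension d T R P E.

Lemma completed_probE (E : set T) : measurable E -> completed_prob E = P E.
Proof. exact: measurable_mu_extE. Qed.

Definition left_accessible_points (A : R -> T -> R) : set R :=
  [set x | 0 < x /\
    (0 < completed_prob [set omega | left_accessible (A ^~ omega) x])%E].

End processes.

(* Main.v *)
Require Import Defs.
From mathcomp Require Import all_boot all_order all_algebra.
From mathcomp Require Import all_classical all_reals all_analysis.
From mathcomp Require Import measurable_realfun.

Import Order.TTheory GRing.Theory Num.Theory.
Import numFieldNormedType.Exports.
Local Open Scope classical_set_scope.
Local Open Scope ring_scope.

(** Fix one right-continuous non-decreasing path [a] with [a 0 = 0], and a level
    [x] with [0 < x <= a t].  The path crosses [x] at one time [s <= t]: it is
    below [x] before [s] and at least [x] from [s] on, and [s] is the last time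
    below [x].  Then [left_lim a s <= x <= a s], so either
    [left_lim a s = x], which says that [x] is left-accessible, or [x] lies in
    the jump interval [`]left_lim a s, a s]].  Since [s] is determined by [x],
    the interval [`]0, a t]] is the disjoint union of the jump intervals at
    times in [`]0, t]] and of the left-accessible levels up to [a t].  Measuring
    with [df] gives, path by path ([path_increment]),
      [f (a t) - f 0 = jump_sum f a t + df (left_accessible_upto a t)],
    so everything depends on whether [df] charges the left-accessible levels.

    It remains to integrate over paths.  Left-accessibility of [x] can be tested
    at rational times ([rational_left_accessibleP]), so the pairs
    [(x, omega)] for which [x] is left-accessible form, up to a null set of
    paths, a measurable subset [accessible_graph] of the product.  By Fubini,
    [df] charges the set of [x] whose section has positive probability if and
    only if [P] charges the set of [omega] whose section has positive [df]-mass
    ([null_xsections_ysections]).  The first set is [left_accessible_points].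
    If it is [df]-null, almost every path has a [df]-null set of left-accessible
    levels, which is (i).  Otherwise, the levels up to [A n] exhaust the
    left-accessible ones as [n] grows, so for some [n] they have positive
    [df]-mass with positive probability, and this persists for [t >= n], which
    is (ii). *)

(** * Measure-theoretic preliminaries *)

(** Countable additivity over an arbitrary countable index set; here the index
    set is the set of jump times, which has no natural enumeration. *)
Lemma measure_bigcup_esum {d} {T : measurableType d} {R : realType}
    (mu : {measure set T -> \bar R}) {I : pointedType} (D : set I)
    (F : I -> set T) :
  countable D -> (forall i, D i -> measurable (F i)) -> trivIset D F ->
  measurable (\bigcup_(i in D) F i) /\
  mu (\bigcup_(i in D) F i) = \esum_(i in D) mu (F i).
Proof.
move=> /countable_bijP[B] /card_esym/card_set_bijP[e e_bij] mF tF.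
have mFe n : B n -> measurable (F (e n)).
  by move=> Bn; apply: mF; case: e_bij => + _ _; apply.
rewrite (reindex_bigcup e B); last 2 first.
- by case: e_bij => + _ _; apply.
- by case: e_bij.
split; first exact: bigcup_measurable.
rewrite measure_bigcup//; last first.
  move=> i j Bi Bj FF; case: e_bij => eD einj _.
  apply: einj; rewrite ?inE//; apply: tF => //; exact: eD.
rewrite nneseries_esum// set_mem_set.
by rewrite (reindex_esum _ _ _ (fun i => mu (F i)) e_bij).
Qed.

(** Each interval contains a rational, so there are at most countably many. *)
Lemma countable_disjoint_itv {R : realType} {I : Type} (D : set I)
    (b c : I -> R) :
  (forall i, D i -> b i < c i) -> trivIset D (fun i => `]b i, c i]%classic) ->
  countable D.
Proof.
move=> bc tD.
(* Indices outside [D] get the whole line, so that all [B i] are nonempty. *)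
pose B i := if i \in D then `]b i, c i[%classic else setT.
apply: (@separated_open_countable R _ B).
- move=> i; rewrite /B; case: ifP => _; [exact: interval_open|exact: openT].
- move=> i; rewrite /B; case: ifPn => [/set_mem/bc bci|_]; last by exists 0.
  by exists ((b i + c i) / 2); rewrite /= in_itv/= !midf_lt.
- move=> i j Di Dj [x]; rewrite /B !mem_set//= !in_itv/=.
  move=> [/andP[bx xc] /andP[bx' xc']]; apply: tD => //.
  by exists x; rewrite /= !in_itv/= bx bx' !ltW.
Qed.

Lemma null_pos_setP {d} {T : measurableType d} {R : realType}
    (m : {measure set T -> \bar R}) (g : T -> \bar R) :
  measurable_fun setT g -> (forall x, 0 <= g x)%E ->
  measurable [set x | 0 < g x]%E /\
  (m [set x | 0 < g x]%E = 0%E <-> (\int[m]_x g x = 0)%E).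
Proof.
move=> mg g0.
have mpos : measurable [set x | 0 < g x]%E.
  by rewrite -[X in measurable X]setTI; exact: emeasurable_fun_o_infty.
split => //.
have -> : (\int[m]_x g x = \int[m]_x `|g x|)%E.
  by apply: eq_integral => x _; rewrite gee0_abs.
rewrite (ae_eq_integral_abs m measurableT mg).
have -> : ae_eq m setT g (cst 0%E) <-> m.-negligible [set x | 0 < g x]%E.
  suff -> : [set x | 0 < g x]%E = ~` [set x | setT x -> g x = cst 0%E x] by [].
  apply/esym/seteqP; split=> x /=.
    by rewrite lt0e g0 andbT => /not_implyP[_ /eqP].
  rewrite lt0e => /andP[/eqP gx0 _]; exact/not_implyP.
by split=> [m0|[B [mB B0 gB]]]; [exact/negligibleP|exact: subset_measure0 gB B0].
Qed.

(** Both null conditions say that [G] is null for the product measure, which is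
    the integral of the section masses in either order. *)
Lemma null_xsections_ysections {d1 d2} {T1 : measurableType d1}
    {T2 : measurableType d2} {R : realType}
    (m1 : {sigma_finite_measure set T1 -> \bar R})
    (m2 : {sigma_finite_measure set T2 -> \bar R}) (G : set (T1 * T2)) :
  measurable G ->
  [/\ measurable [set x | 0 < m2 (xsection G x)]%E,
      measurable [set y | 0 < m1 (ysection G y)]%E &
      m1 [set x | 0 < m2 (xsection G x)]%E = 0%E <->
      m2 [set y | 0 < m1 (ysection G y)]%E = 0%E].
Proof.
move=> mG.
have mx := measurable_fun_xsection m2 mG.
have my := measurable_fun_ysection m1 mG.
have [m1x /= m1xE] := null_pos_setP m1 _ mx (fun=> measure_ge0 _ _).
have [m2y /= m2yE] := null_pos_setP m2 _ my (fun=> measure_ge0 _ _).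
split=> //.
have fubini : (\int[m1]_x m2 (xsection G x) = \int[m2]_y m1 (ysection G y))%E.
  apply: (@product_measure_unique _ _ _ _ _ m1 m2 (m1 \x^ m2)%E) => // B C mB mC.
  exact: product_measure2E.
by split=> [/m1xE|/m2yE]; [rewrite fubini => /m2yE|rewrite -fubini => /m1xE].
Qed.

(** * Left limits and the decomposition of a single path *)

Lemma cvg_left_lim {R : realType} (a : R -> R) s :
  nondecreasing_ge0 a -> 0 < s -> cvg (a u @[u --> s^'-]).
Proof.
move=> nda s0; apply: nondecreasing_at_left_is_cvgr.
- near=> x => u v; rewrite !in_itv/= => /andP[xu _] _ uv.
  apply: nda => //; apply: le_trans (ltW xu).
  by near: x; exact: nbhs_left_ge.
- near=> x; exists (a s) => y [u /=]; rewrite in_itv/= => /andP[xu us] <-.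
  apply: nda (ltW us); apply: le_trans (ltW xu).
  by near: x; exact: nbhs_left_ge.
Unshelve. all: by end_near. Qed.

Lemma le_left_lim {R : realType} (a : R -> R) u s :
  nondecreasing_ge0 a -> 0 <= u -> u < s -> a u <= left_lim a s.
Proof.
move=> nda u0 us; apply: limr_ge; first exact/cvg_left_lim/(le_lt_trans u0 us).
by near=> v; apply: nda => //; near: v; exact: nbhs_left_ge.
Unshelve. all: by end_near. Qed.

Lemma left_lim_le {R : realType} (a : R -> R) s y :
  nondecreasing_ge0 a -> 0 < s -> (forall u, 0 <= u -> u < s -> a u <= y) ->
  left_lim a s <= y.
Proof.
move=> nda s0 ay; apply: limr_le; first exact: cvg_left_lim.
by near=> v; apply: ay; near: v; [exact: nbhs_left_ge|exact: nbhs_left_lt].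
Unshelve. all: by end_near. Qed.

(** Typed as a set of [measurableTypeR R], the measurable space that carries
    Lebesgue-Stieltjes measures. *)
Definition left_accessible_upto {R : realType} (a : R -> R) (t : R) :
    set (measurableTypeR R) :=
  [set x | left_accessible a x /\ x <= a t].

Definition crosses_at {R : realType} (a : R -> R) (x s : R) :=
  [/\ 0 < s, forall u, 0 <= u -> u < s -> a u < x & x <= a s].

(** Only countably many values of [a] enter, so for a process this is a measurable
    condition on the pair [(x, omega)], whatever the regularity of the paths. *)
Definition rational_left_accessible {R : realType} (a : R -> R) (x : R) :=
  [/\ 0 < x, exists n : nat, x <= a n%:R &
      forall k : nat, exists q : rat,
        [/\ 0 <= q, x - k.+1%:R^-1 < a (ratr q) & a (ratr q) < x]].

Section path.
Context {R : realType} {a : R -> R}.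
Context (a_incr : increasing_path a).

Let a0 : a 0 = 0. Proof. by case: a_incr. Qed.
Let nda : nondecreasing_ge0 a. Proof. by case: a_incr. Qed.

Lemma below_right (s x : R) : 0 <= s -> a s < x -> exists2 u, s < u & a u < x.
Proof.
move=> s0 asx; case: a_incr => _ /(_ s s0) rca _.
near s^'+ => u; exists u; first by near: u; exact: nbhs_right_gt.
by near: u; exact: (cvgr_lt _ rca).
Unshelve. all: by end_near. Qed.

(** The crossing time is the supremum of the times below [x]: right-continuity
    at [0] makes it positive, and right-continuity at the supremum shows that
    the path has reached [x] by then. *)
Lemma crossing (x t : R) : 0 < x -> 0 <= t -> x <= a t ->
  exists2 s, s <= t & crosses_at a x s.
Proof.
move=> x0 t0 xat.
pose S := [set u : R | 0 <= u /\ a u < x].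
have S0 : S 0 by split; rewrite ?a0.
have St : ubound S t.
  move=> u [u0 aux]; rewrite leNgt; apply/negP => tu.
  by have := lt_le_trans aux (le_trans xat (nda _ _ t0 (ltW tu))); rewrite ltxx.
have supS : has_sup S by split; [exists 0|exists t].
exists (sup S); first by apply: ge_sup => //; exists 0.
have supS0 : 0 <= sup S by apply: ub_le_sup => //; exists t.
split.
- have [u u0 aux] : exists2 u, 0 < u & a u < x.
    by apply: below_right; rewrite ?a0.
  apply: (lt_le_trans u0); apply: ub_le_sup; first by exists t.
  by split; first exact: ltW.
- move=> u u0 /(sup_gt (ex_intro _ 0 S0))[v [v0 avx] uv].
  by apply: le_lt_trans avx; apply: nda => //; exact: ltW.
- rewrite leNgt; apply/negP => /(below_right _ _ supS0)[u su aux].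
  have : u <= sup S.
    apply: ub_le_sup; first by exists t.
    by split => //; exact: le_trans supS0 (ltW su).
  by rewrite leNgt su.
Qed.

(** The path is below [x] before [s] and not from [s] on.  So a level has at most
    one crossing time, which makes the jump intervals disjoint from each other
    and from the left-accessible levels. *)
Lemma last_time_below_crossing (x s : R) :
  crosses_at a x s -> last_time_below a x = s%:E.
Proof.
move=> [s0 ltx xs]; apply/eqP; rewrite eq_le; apply/andP; split.
  apply: ge_ereal_sup => _ [u [u0 aux] <-]; rewrite lee_fin leNgt.
  apply/negP => su; have := le_trans xs (nda _ _ (ltW s0) (ltW su)).
  by rewrite leNgt aux.
apply/lee_subgt0Pr => e e0.
have [s0e|se0] := ltP 0 (s - e).
  apply: ereal_sup_ubound; exists (s - e) => //; split; first exact: ltW.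
  by apply: ltx; [exact: ltW|rewrite ltrBlDr ltrDl].
apply: (@le_trans _ _ 0%E); first by rewrite -EFinB lee_fin.
by apply: ereal_sup_ubound; exists 0 => //; split => //; exact: ltx.
Qed.

Lemma left_accessibleP (x : R) :
  left_accessible a x <->
  exists2 s, crosses_at a x s & left_lim a s = x.
Proof.
split=> [[x0 Loo Lx]|[s xs asx]]; last first.
  rewrite /left_accessible (last_time_below_crossing _ _ xs) ltry; split => //.
  case: xs => s0 ltx _; have := ltx 0 (lexx _) s0; by rewrite a0.
have [t t0 xat] : exists2 t, 0 <= t & x <= a t.
  apply/not_exists2P => xa.
  suff : last_time_below a x = +oo%E by move=> L; rewrite L ltxx in Loo.
  apply/eqyP => A A0; apply: ereal_sup_ubound; exists A => //.
  split; first exact: ltW.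
  by have [/negP|/negP] := xa A; rewrite -?ltNge// ltNge (ltW A0).
have [s _ xs] := crossing _ _ x0 t0 xat; exists s => //.
by rewrite (last_time_below_crossing _ _ xs) in Lx.
Qed.

Lemma left_lim_le_value (s : R) : 0 < s -> left_lim a s <= a s.
Proof. by move=> s0; apply: left_lim_le => // u u0 us; exact/nda/ltW. Qed.

Lemma left_lim_ge0 (s : R) : 0 < s -> 0 <= left_lim a s.
Proof. by move=> s0; rewrite -a0; exact: le_left_lim. Qed.

Lemma jump_crossing (s x : R) :
  0 < s -> left_lim a s < x -> x <= a s -> crosses_at a x s.
Proof.
by move=> s0 sx xs; split => // u u0 us; apply: le_lt_trans sx; exact: le_left_lim.
Qed.

(** Since a path is at least [x] from its crossing time [s] on, rational times
    where it is strictly below [x] precede [s], so values there that approach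
    [x] force [left_lim a s = x]. *)
Lemma rational_left_accessibleP (x : R) :
  left_accessible a x <-> rational_left_accessible a x.
Proof.
split=> [/left_accessibleP[s [s0 ltx xs] asx]|[x0 [n xn] xq]].
  split.
  - by rewrite -a0; exact: ltx.
  - exists (Num.truncn s).+1; apply: le_trans xs _; apply: nda; first exact: ltW.
    by apply: ltW; exact: truncnS_gt.
  - move=> k; have xk : x - k.+1%:R^-1 < left_lim a s.
      by rewrite asx ltrBlDr ltrDl invr_gt0.
    have [u [u0 us xau]] : exists u, [/\ 0 <= u, u < s & x - k.+1%:R^-1 < a u].
      apply: contrapT => H; have : left_lim a s <= x - k.+1%:R^-1.
        apply: left_lim_le => // u u0 us; rewrite leNgt; apply/negP => xu.
        by apply: H; exists u.
      by rewrite leNgt xk.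
    have [q] := rat_in_itvoo us; rewrite in_itv/= => /andP[uq qs].
    have q0 : 0 <= ratr q :> R by exact: le_trans u0 (ltW uq).
    exists q; split; first by rewrite ler0q in q0.
    + by apply: lt_le_trans xau _; apply: nda => //; exact: ltW.
    + exact: ltx.
have [s _ xs] := crossing _ _ x0 (ler0n _ n) xn.
apply/left_accessibleP; exists s => //; case: xs => s0 ltx xs.
apply/eqP; rewrite eq_le; apply/andP; split.
  by apply: left_lim_le => // u u0 us; exact/ltW/ltx.
rewrite leNgt; apply/negP => sx.
have [k kx] : exists k : nat, k.+1%:R^-1 < x - left_lim a s.
  have e0 : 0 < x - left_lim a s by rewrite subr_gt0.
  have [N _ /(_ N (leqnn N))] := near_infty_natSinv_lt (PosNum e0).
  by exists N.
have [q [q0 xq1 xq2]] := xq k.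
have q0R : 0 <= ratr q :> R by rewrite ler0q.
have qs : ratr q < s.
  rewrite ltNge; apply/negP => sq.
  by have := lt_le_trans xq2 (le_trans xs (nda _ _ (ltW s0) sq)); rewrite ltxx.
have := le_left_lim _ _ _ nda q0R qs; rewrite leNgt => /negP; apply.
by apply: lt_trans xq1; rewrite ltrBrDr -ltrBrDl.
Qed.

(** The interval [`]0, a t]] splits into the jump intervals at times up to [t]
    and the left-accessible levels. *)
Lemma path_increment (f : stieltjes_fun R) (t : R) : 0 <= t ->
  measurable (left_accessible_upto a t) /\
  (f (a t) - f 0)%:E =
    (jump_sum f a t + stieltjes_measure f (left_accessible_upto a t))%E.
Proof.
move=> t0.
pose mu : {measure set (measurableTypeR R) -> \bar R} :=
  lebesgue_stieltjes_measure (extend_left f).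
pose I s := (`]left_lim a s, a s]%classic : set (measurableTypeR R)).
pose J := [set s | 0 < s <= t /\ left_lim a s < a s].
pose acc := left_accessible_upto a t.
have muE (x y : R) : 0 <= x -> x <= y ->
    mu (`]x, y]%classic : set (measurableTypeR R)) = (f y - f x)%:E.
  exact: stieltjes_measure_itv.
have IL s x : 0 < s -> I s x -> last_time_below a x = s%:E.
  move=> s0; rewrite /I/= in_itv/= => /andP[sx xs].
  exact/last_time_below_crossing/jump_crossing.
have tI : trivIset J I.
  move=> s s' [/andP[s0 _] _] [/andP[s'0 _] _] [x [/IL Is /IL Is']].
  by have := Is s0; rewrite (Is' s'0) => -[].
have cJ : countable J.
  by apply: (@countable_disjoint_itv R R J (left_lim a) a) => // s [].
have mI s : J s -> measurable (I s) by move=> _; exact: measurable_itv.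
have [mUI muUI] := measure_bigcup_esum mu J I cJ mI tI.
have jumpE : jump_sum f a t = mu (\bigcup_(s in J) I s).
  rewrite muUI /jump_sum.
  have -> : J = [set s | 0 < s <= t] `&` [set s | left_lim a s < a s] by [].
  (* Times without a jump contribute zero to the jump sum. *)
  rewrite esum_mkcondr; apply: eq_esum => s /andP[s0 _].
  rewrite muE ?left_lim_ge0 ?left_lim_le_value//.
  case: ifPn => //; rewrite notin_setE => /negP.
  rewrite -leNgt => sa; congr (_%:E).
  suff -> : left_lim a s = a s by rewrite subrr.
  by apply/eqP; rewrite eq_le sa left_lim_le_value.
have at0 : 0 <= a t by rewrite -a0; exact: nda.
have accE : acc = `]0, a t]%classic `\` \bigcup_(s in J) I s.
  apply/seteqP; split=> x.
    move=> [accx xat]; split.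
      by rewrite /= in_itv/= xat andbT; case: accx.
    move=> [s [/andP[s0 _] _] Isx].
    case: accx => _ _; rewrite (IL _ _ s0 Isx)/= => sx.
    by move: Isx; rewrite /I/= in_itv/= sx ltxx.
  move=> [/=]; rewrite in_itv/= => /andP[x0 xat] nI; split => //.
  have [s st xs] := crossing _ _ x0 t0 xat.
  apply/left_accessibleP; exists s => //; case: xs => s0 ltx xs.
  apply/eqP; rewrite eq_le left_lim_le//=; last first.
    by move=> u u0 us; exact/ltW/ltx.
  rewrite leNgt; apply/negP => sx; apply: nI; exists s.
    by split; [rewrite s0 st|exact: lt_le_trans sx xs].
  by rewrite /I/= in_itv/= sx xs.
have UIsub : \bigcup_(s in J) I s `<=` `]0, a t]%classic.
  move=> x [s [/andP[s0 st] _]]; rewrite /I /= !in_itv/= => /andP[sx xs].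
  rewrite (le_lt_trans (left_lim_ge0 _ s0) sx)/= (le_trans xs)//.
  by apply: nda => //; exact: ltW.
have mt : measurable (`]0, a t]%classic : set (measurableTypeR R)).
  exact: measurable_itv.
have macc : measurable acc by rewrite accE; exact: measurableD.
split => //.
rewrite jumpE -[stieltjes_measure f _]/(mu acc) -muE//.
rewrite -[in LHS](setDUK UIsub) measureU//; first by rewrite accE.
- by rewrite -accE.
- by apply/seteqP; split => // x [? []].
Qed.

(** The left-accessible mass makes the inequality strict because the jump sum is
    finite, being bounded by the increment. *)
Lemma jump_sum_lt_increment (f : stieltjes_fun R) (t : R) : 0 <= t ->
  (0 < stieltjes_measure f (left_accessible_upto a t))%E ->
  (jump_sum f a t < (f (a t) - f 0)%:E)%E.
Proof.
move=> t0 acc0; have [_ E] := path_increment f t t0.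
have js0 : (0 <= jump_sum f a t)%E.
  apply: esum_ge0 => s /andP[s0 st].
  rewrite lee_fin subr_ge0; apply: stieltjes_fun_nd.
    exact: left_lim_ge0.
  exact: left_lim_le_value.
have jsfin : jump_sum f a t \is a fin_num.
  rewrite ge0_fin_numE//; apply: (@le_lt_trans _ _ (f (a t) - f 0)%:E).
    by rewrite E leeDl// ltW.
  exact: ltry.
by rewrite E lteDl.
Qed.

End path.

(** * Almost sure comparison with completed probabilities *)

Section completed.
Context {d} {T : measurableType d} {R : realType} (P : probability T R).

Lemma le_completed_prob (E F : set T) :
  E `<=` F -> (completed_prob P E <= completed_prob P F)%E.
Proof. exact: le_mu_ext. Qed.

(** Path properties hold only almost surely, so an event of interest is compared
    with a measurable one up to a null set of paths. *)
Lemma completed_prob_ge (F E : set T) : measurable F ->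
  {ae P, forall w, F w -> E w} -> (P F <= completed_prob P E)%E.
Proof.
move=> mF [N [mN N0 FEN]].
have -> : P F = P (F `\` N).
  rewrite (measureDI P mF mN) [X in (_ + X)%E](_ : _ = 0%E) ?adde0//.
  by apply: subset_measure0 N0 => //; exact: measurableI.
rewrite -completed_probE; last exact: measurableD.
apply: le_completed_prob => w [Fw nNw]; apply: contrapT => nEw.
by apply: nNw; apply: FEN => /(_ Fw).
Qed.

Lemma completed_prob_le (F E : set T) : measurable F ->
  {ae P, forall w, E w -> F w} -> (completed_prob P E <= P F)%E.
Proof.
move=> mF [N [mN N0 EFN]].
apply: (@le_trans _ _ (P (F `|` N))); last first.
  apply: le_trans (measureU2 P mF mN) _.
  by rewrite [X in (_ + X)%E](_ : _ = 0%E)// adde0.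
rewrite -completed_probE; last exact: measurableU.
apply: le_completed_prob => w Ew; have [Fw|nFw] := pselect (F w); [by left|right].
by apply: EFN => /(_ Ew).
Qed.

End completed.

(** * The graph of left-accessible levels *)

Lemma measurable_set_lt {d} {X : measurableType d} {R : realType}
    (g h : X -> R) :
  measurable_fun setT g -> measurable_fun setT h ->
  measurable [set z | g z < h z].
Proof.
move=> mg mh; have /(_ measurableT [set true] I) := measurable_fun_ltr mg mh.
by rewrite setTI.
Qed.

Lemma measurable_set_le {d} {X : measurableType d} {R : realType}
    (g h : X -> R) :
  measurable_fun setT g -> measurable_fun setT h ->
  measurable [set z | g z <= h z].
Proof.
move=> mg mh; have /(_ measurableT [set true] I) := measurable_fun_ler mg mh.
by rewrite setTI.
Qed.

Section graph.
Context {d} {T : measurableType d} {R : realType} (A : R -> T -> R).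
Context (mA : forall t, 0 <= t -> measurable_fun setT (A t)).

Definition accessible_graph : set (measurableTypeR R * T) :=
  [set z | rational_left_accessible (A ^~ z.2) z.1].

Definition accessible_graph_upto (t : R) : set (measurableTypeR R * T) :=
  accessible_graph `&` [set z | z.1 <= A t z.2].

Let mfst : measurable_fun setT (fun z : measurableTypeR R * T => z.1 : R).
Proof. exact: measurable_fst. Qed.

Let mAsnd t : 0 <= t ->
  measurable_fun setT (fun z : measurableTypeR R * T => A t z.2).
Proof. by move=> t0; exact: (measurableT_comp (mA t t0) measurable_snd). Qed.

Lemma measurable_accessible_graph_upto t : 0 <= t ->
  measurable (accessible_graph_upto t).
Proof.
move=> t0; apply: measurableI; last first.
  by apply: measurable_set_le; [exact: mfst|exact: mAsnd].
have -> : accessible_graph = [set z | 0 < z.1] `&`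
   ((\bigcup_n [set z | z.1 <= A n%:R z.2]) `&`
    (\bigcap_k \bigcup_(q in [set q : rat | 0 <= q])
       ([set z | z.1 - k.+1%:R^-1 < A (ratr q) z.2] `&`
        [set z | A (ratr q) z.2 < z.1]))).
  apply/seteqP; split=> z.
    move=> [z0 [n zn] zq]; split=> //; split; first by exists n.
    by move=> k _; have [q [q0 zq1 zq2]] := zq k; exists q.
  move=> [z0 [[n _ zn] zq]]; split=> //; first by exists n.
  by move=> k; have [q q0 [zq1 zq2]] := zq k I; exists q.
apply: measurableI.
  by apply: measurable_set_lt; [exact: measurable_cst|exact: mfst].
apply: measurableI.
  apply: bigcupT_measurable => n; apply: measurable_set_le; first exact: mfst.
  exact: mAsnd.
apply: bigcapT_measurable => k; rewrite bigcup_mkcond.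
apply: bigcupT_measurable_rat => q; case: ifPn => [|_]; last exact: measurable0.
rewrite inE/= => q0.
have q0R : 0 <= ratr q :> R by rewrite ler0q.
apply: measurableI; apply: measurable_set_lt;
  [|exact: mAsnd|exact: mAsnd|exact: mfst].
by apply: measurable_funB; [exact: mfst|exact: measurable_cst].
Qed.

(** Left-accessible levels are reached in finite time, hence by some integer time;
    countability of these times is what singles out one threshold for (ii). *)
Lemma accessible_graph_bigcup :
  accessible_graph = \bigcup_(n : nat) accessible_graph_upto n%:R.
Proof.
apply/seteqP; split=> z; last by move=> [n _ []].
by move=> zA; case: (zA) => _ [n zn] _; exists n.
Qed.

Lemma measurable_accessible_graph : measurable accessible_graph.
Proof.
rewrite accessible_graph_bigcup; apply: bigcupT_measurable => n.
exact: measurable_accessible_graph_upto.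
Qed.

End graph.

(** * Integration over the paths *)

Section process.
Context {d} {T : measurableType d} {R : realType} {P : probability T R}.
Context {A : R -> T -> R} (incrA : increasing_process P A).

(** Turns the completed probabilities that define the left-accessible points
    into section probabilities, to which Fubini applies. *)
Lemma left_accessible_pointsE :
  left_accessible_points P A =
  [set x | (0 < P (xsection (accessible_graph A) x))%E].
Proof.
case: incrA => mA _ aeA.
have mx x : measurable (xsection (accessible_graph A) x).
  by apply: measurable_xsection; exact: measurable_accessible_graph.
have cE (x : R) : completed_prob P [set w | left_accessible (A ^~ w) x] =
    P (xsection (accessible_graph A) x).
  apply/eqP; rewrite eq_le; apply/andP; split.
  - apply: completed_prob_le => //; apply: filterS aeA => w incrw.
    by move=> /(rational_left_accessibleP incrw); rewrite xsectionE.
  - apply: completed_prob_ge => //; apply: filterS aeA => w incrw.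
    by rewrite xsectionE => /(rational_left_accessibleP incrw).
apply/seteqP; split=> x; rewrite /left_accessible_points/= cE; first by case.
move=> Px.
split=> //; rewrite ltNge; apply/negP => x0; move: Px.
rewrite [xsection _ _](_ : _ = set0) ?measure0 ?ltxx//.
rewrite -subset0 xsectionE => w [+ _ _]; by rewrite ltNge x0.
Qed.

End process.

Theorem theorem1 (d : measure_display) (T : measurableType d) (R : realType)
    (P : probability T R) (A : R -> T -> R) (f : stieltjes_fun R) :
  increasing_process P A ->
  (stieltjes_measure f (left_accessible_points P A) = 0%E ->
    {ae P, forall omega, forall t : R, 0 <= t ->
      (f (A t omega) - f 0)%:E = jump_sum f (A ^~ omega) t}) /\
  ((0 < stieltjes_measure f (left_accessible_points P A))%E ->
    \forall t \near +oo%R,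
      (0 < completed_prob P [set omega |
        jump_sum f (A ^~ omega) t < (f (A t omega) - f 0)%:E])%E).
Proof.
move=> incrA; case: (incrA) => mA _ aeA.
pose mu : {sigma_finite_measure set (measurableTypeR R) -> \bar R} :=
  lebesgue_stieltjes_measure (extend_left f).
have mG := measurable_accessible_graph A mA.
have mGn n := measurable_accessible_graph_upto A mA n%:R (ler0n _ n).
rewrite (left_accessible_pointsE incrA) /stieltjes_measure -/mu.
have [mx my xy] := null_xsections_ysections mu P _ mG.
split=> [/xy null|pos].
  have : {ae P, forall w, ~ (0 < mu (ysection (accessible_graph A) w))%E}.
    exists [set w | 0 < mu (ysection (accessible_graph A) w)]%E; split => //.
    by move=> w /= /contrapT.
  apply: filterS2 aeA => w incrw muw t t0.
  have [macc ->] := path_increment incrw f t t0.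
  rewrite [X in (_ + X)%E](_ : _ = 0%E) ?adde0//.
  apply/eqP; rewrite eq_le measure_ge0 andbT leNgt.
  apply/negP => accw; apply: muw; apply: (lt_le_trans accw).
  apply: le_measure; rewrite ?inE//; first exact: measurable_ysection.
  by move=> x [/(rational_left_accessibleP incrw) + _]; rewrite ysectionE.
pose N n := [set w | (0 < mu (ysection (accessible_graph_upto A n%:R) w))%E].
have mN n : measurable (N n) by have [] := null_xsections_ysections mu P _ (mGn n).
(* If every [N n] were null, so would be their union, which contains all
   [omega] with a section of positive mass. *)
have [n PN] : exists n, (0 < P (N n))%E.
  apply/not_existsP => N0; move: pos; rewrite lt0e => /andP[/eqP + _]; apply.
  apply/xy; apply: (@subset_measure0 _ _ _ P _ (\bigcup_n N n)) => //.
  - exact: bigcupT_measurable.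
  - move=> w /= Gw; apply: contrapT => nN; move: Gw; apply/negP.
    rewrite -leNgt accessible_graph_bigcup ysection_bigcup.
    suff : mu.-negligible
        (\bigcup_n ysection (accessible_graph_upto A n%:R) w).
      move=> /negligibleP ->//; apply: bigcupT_measurable => n.
      exact: measurable_ysection.
    apply: negligible_bigcup => n; apply/negligibleP.
      exact: measurable_ysection.
    apply/eqP; rewrite eq_le measure_ge0 andbT leNgt; apply/negP => Gnw.
    by apply: nN; exists n.
  - apply/negligibleP; first exact: bigcupT_measurable.
    apply: negligible_bigcup => n; apply/negligibleP => //.
    by apply/eqP; rewrite eq_le measure_ge0 andbT leNgt; apply/negP/N0.
(* A path in [N n] charges the levels reached by time [n], which are also
   reached by every later time [t]. *)
near=> t; apply: (lt_le_trans PN); apply: completed_prob_ge => //.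
have nt : n%:R <= t by near: t; exact: nbhs_pinfty_ge.
have t0 : 0 <= t by exact: le_trans nt.
apply: filterS aeA => w incrw Nw /=; apply: (jump_sum_lt_increment incrw) => //.
apply: (lt_le_trans Nw).
have [macc _] := path_increment incrw f t t0.
apply: (@le_measure _ _ _ mu); rewrite ?inE//; first exact: measurable_ysection.
move=> x; rewrite ysectionE => -[/(rational_left_accessibleP incrw) accx xn].
split=> //; apply: (le_trans xn).
by case: incrw => _ _; apply.
Unshelve. all: by end_near. Qed.
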